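(* Let $n\ge1$, let $a_0,\dots,a_n$ and $x$ be real numbers, let $P(x)=\sum_{i=0}^n a_ix^i$ and assume $P(x)\ne0$. Let $\widehat r_{2n}=\widehat P(x)$ be the value computed by Horner's rule under SR-nearness with $u=\beta^{1-p}$: $\widehat r_0=a_n$ and, for $1\le k\le n$, $$\widehat r_{2k-1}=\widehat r_{2k-2}\,x\,(1+\delta_{2k-1}),\qquad \widehat r_{2k}=(\widehat r_{2k-1}+a_{n-k})(1+\delta_{2k}),$$ where $\delta_{2k-1},\delta_{2k}$ are the SR-nearness relative errors of the product and of the addition; let $r_{2n}=P(x)$ be the exact value. Then $E(\widehat r_{2n})=r_{2n}$ and $$V(\widehat r_{2n})\le r_{2n}^2\,\mathcal K_1^2\,\gamma_{2n}(u^2),$$ where $\mathcal K_1=\dfrac{\sum_{i=0}^n|a_ix^i|}{\left|\sum_{i=0}^n a_ix^i\right|}$ and $\gamma_{2n}(u^2)=(1+u^2)^{2n}-1$.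
   Context: Floating-point numbers: fix a base $\beta\ge2$ and precision $p\ge1$ (integers); $\mathcal F$ is the set of normal floating-point numbers $\pm m\beta^{e-p}$ with $m,e$ integers and $\beta^{p-1}\le m<\beta^p$ (underflow and overflow are ignored, so $e$ ranges over all integers). Put $u=\beta^{1-p}$. For real $x\ne0$, $\lceil x\rceil=\min\{y\in\mathcal F:y\ge x\}$, $\lfloor x\rfloor=\max\{y\in\mathcal F:y\le x\}$, and, for $x\notin\mathcal F$, $\theta(x)=(x-\lfloor x\rfloor)/(\lceil x\rceil-\lfloor x\rfloor)$. SR-nearness (stochastic rounding): for $x\notin\mathcal F\cup\{0\}$, $\mathrm{fl}(x)=\lceil x\rceil$ with probability $\theta(x)$ and $\mathrm{fl}(x)=\lfloor x\rfloor$ with probability $1-\theta(x)$; if $x\in\mathcal F\cup\{0\}$, $\mathrm{fl}(x)=x$. In a sequence of elementary operations $c_k\leftarrow a_k\,\mathrm{op}_k\,b_k$, $\mathrm{op}_k\in\{+,-,*,/\}$, whose operands are data or previously computed values, each rounding is made with these probabilities conditionally on all previous roundings. The relative error $\delta_k$ of the $k$th operation is defined by $\widehat c_k=\mathrm{fl}(\widehat a_k\,\mathrm{op}_k\,\widehat b_k)=(\widehat a_k\,\mathrm{op}_k\,\widehat b_k)(1+\delta_k)$, with $\delta_k=0$ when the exact result is $0$. It is known that $|\delta_k|\le u$ and $\mathbb{E}[\delta_k\mid\delta_1,\dots,\delta_{k-1}]=\mathbb{E}(\delta_k)=0$ for all $k$ (mean independence). Here the operations are performed in the order of the indices $1,2,\dots,2n$,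 and input data are used exactly. $E$ and $V$ denote expectation and variance. *)

(* Defs.v *)
From HB Require Import structures.
From mathcomp Require Import all_boot all_order all_algebra.
From mathcomp Require Import all_classical all_reals all_analysis.

Set Implicit Arguments.
Unset Strict Implicit.
Unset Printing Implicit Defensive.
Import Order.TTheory GRing.Theory Num.Theory.
Local Open Scope classical_set_scope.
Local Open Scope ring_scope.

(* The exponent e is unbounded: no underflow or overflow.  Zero is not in
   [floats]. *)
Definition floats (R : realType) (beta p : nat) : set R :=
  [set y | exists (s : bool) (m : nat) (e : int),
     (beta ^ (p - 1) <= m < beta ^ p)%N /\
     y = (-1) ^+ s * m%:R * beta%:R ^ (e - p%:Z)].

Definition unit_roundoff (R : realType) (beta p : nat) : R :=
  beta%:R ^ (1 - p%:Z).

(* [A `&` lbound A] is the set of minima of A (at most one element).  The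
   default 0 is reached (if 2 <= beta, 1 <= p) only for x = 0, where the minimum
   (resp. maximum) does
   not exist; [fl_mass] never uses that value. *)
Definition fceil (R : realType) (beta p : nat) (x : R) : R :=
  let A := [set y | floats beta p y /\ x <= y] in xget 0 (A `&` lbound A).

Definition ffloor (R : realType) (beta p : nat) (x : R) : R :=
  let A := [set y | floats beta p y /\ y <= x] in xget 0 (A `&` ubound A).

Definition ftheta (R : realType) (beta p : nat) (x : R) : R :=
  (x - ffloor beta p x) / (fceil beta p x - ffloor beta p x).

(* The probability that fl(x) = y under SR-nearness. *)
Definition fl_mass (R : realType) (beta p : nat) (x y : R) : R :=
  if x \in floats beta p `|` [set 0] then (y == x)%:R
  else ftheta beta p x * (y == fceil beta p x)%:R
       + (1 - ftheta beta p x) * (y == ffloor beta p x)%:R.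

(* A computation of N elementary operations, numbered from 1, is given by
   [exact]: [exact d k] is the exact result of the k-th operation applied to
   the computed operands when the relative errors made so far are
   d 1, ..., d (k - 1).  The computed k-th result is thus
   exact d k * (1 + d k).
   [SR_errors] says that delta 1, ..., delta N are the relative errors of that
   computation under SR-nearness: conditionally on the values of
   delta 1, ..., delta (k - 1), the k-th computed result has the law of
   fl(exact d k).  The conditional probability is written in product form,
   Pr(H /\ E) = Pr(E | H) Pr(H), so that null histories H need no special
   treatment; conditioning on point values loses nothing because the errors
   take finitely many values almost surely. *)
Definition SR_errors (dsp : measure_display) (T : measurableType dsp)
    (R : realType) (P : probability T R) (beta p N : nat)
    (exact : (nat -> R) -> nat -> R) (delta : nat -> {RV P >-> R}) : Prop :=
  forall k : nat, (1 <= k <= N)%N ->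
    (forall t : T, exact (fun j => delta j t) k = 0 -> delta k t = 0) /\
    (forall (d : nat -> R) (y : R),
       let H := [set t : T | forall j, (1 <= j < k)%N -> delta j t = d j] in
       P (H `&` [set t | exact (fun j => delta j t) k * (1 + delta k t) = y])
       = ((fl_mass beta p (exact d k) y)%:E * P H)%E).

(* The k-th operation of Horner's rule (k >= 1) applied to the previous
   value r: a product by x for k = 2i - 1, the addition of a_(n-i) for
   k = 2i. *)
Definition horner_op (R : realType) (n : nat) (a : nat -> R) (x : R)
    (k : nat) (r : R) : R :=
  if odd k then r * x else r + a (n - k./2)%N.

Fixpoint horner_hat (R : realType) (n : nat) (a : nat -> R) (x : R)
    (d : nat -> R) (k : nat) : R :=
  if k is k'.+1 then
    horner_op n a x k (horner_hat n a x d k') * (1 + d k)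
  else a n.

Definition horner_exact (R : realType) (n : nat) (a : nat -> R) (x : R)
    (d : nat -> R) (k : nat) : R :=
  horner_op n a x k (horner_hat n a x d k.-1).

Lemma horner_hat_mul (R : realType) (n : nat) (a : nat -> R) (x : R)
    (d : nat -> R) (k : nat) : (1 <= k)%N ->
  horner_hat n a x d (2 * k - 1) =
  horner_hat n a x d (2 * k - 2) * x * (1 + d (2 * k - 1)%N).
Proof.
case: k => // k _.
rewrite (_ : 2 * k.+1 - 1 = (2 * k).+1)%N; last by rewrite mulnS.
rewrite (_ : 2 * k.+1 - 2 = 2 * k)%N; last by rewrite mulnS addKn.
by rewrite /= /horner_op /= mul2n odd_double.
Qed.

Lemma horner_hat_add (R : realType) (n : nat) (a : nat -> R) (x : R)
    (d : nat -> R) (k : nat) : (1 <= k)%N ->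
  horner_hat n a x d (2 * k) =
  (horner_hat n a x d (2 * k - 1) + a (n - k)%N) * (1 + d (2 * k)%N).
Proof.
case: k => // k _.
rewrite (_ : 2 * k.+1 - 1 = (2 * k).+1)%N; last by rewrite mulnS.
rewrite (_ : 2 * k.+1 = (2 * k).+2)%N; last by rewrite mulnS.
by rewrite [LHS]/= {1}/horner_op /= !mul2n odd_double /= doubleK.
Qed.

Definition poly_val (R : realType) (n : nat) (a : nat -> R) (x : R) : R :=
  \sum_(i < n.+1) a i * x ^+ i.

Definition cond_K1 (R : realType) (n : nat) (a : nat -> R) (x : R) : R :=
  (\sum_(i < n.+1) `|a i * x ^+ i|) / `|\sum_(i < n.+1) a i * x ^+ i|.

Definition gamma (R : realType) (m : nat) (v : R) : R := (1 + v) ^+ m - 1.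

(* Main.v *)
(* Conditionally on the past, a rounding error takes at most two values, has
   mean zero and second moment at most u^2.  The law of the errors is thus
   carried by a binary tree, and expectations are iterated two-point means.
   Running these means through Horner's rule gives E(r_k) = r_k exactly, and,
   with S_k the value of Horner's rule on |a_i| and |x|,
     E(r_k^2) <= r_k^2 + S_k^2 ((1 + u^2)^k - 1)
   by induction on k: a step s = al * r + be multiplies the second moment by at
   most 1 + u^2, and |al * r + be| <= |al| * S + |be| absorbs the surplus.  At
   k = 2n, S_k is the sum of the |a_i x^i|, i.e. |P(x)| K_1. *)
Require Import Defs.
From HB Require Import structures.
From mathcomp Require Import all_boot all_order all_algebra.
From mathcomp Require Import all_classical all_reals all_analysis.
From mathcomp Require Import measurable_realfun ring lra.

Set Implicit Arguments.
Unset Strict Implicit.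
Unset Printing Implicit Defensive.
Import Order.TTheory GRing.Theory Num.Theory.
Local Open Scope classical_set_scope.
Local Open Scope ring_scope.

(** * Floating-point neighbours of a real number *)

Lemma exists_exprz_itv (R : realType) (beta : nat) (x : R) :
  (2 <= beta)%N -> 0 < x ->
  exists e : int, beta%:R ^ (e - 1) <= x < beta%:R ^ e.
Proof.
move=> beta2 x0.
have b0 : (0 : R) < beta%:R by rewrite ltr0n (leq_trans _ beta2).
have pow_gt (y : R) : 0 <= y -> exists M : nat, y < beta%:R ^+ M.
  move=> y0; exists (Num.bound y).
  apply: lt_trans (archi_boundP y0) _.
  by rewrite -natrX ltr_nat ltn_expl.
have [M xM] := pow_gt x (ltW x0).
have [N xN] : exists N : nat, x^-1 < beta%:R ^+ N.
  by apply: pow_gt; rewrite invr_ge0 ltW.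
(* Exponents are shifted by [N] so that the least one can be sought among natural numbers; [j] = 0
   is then excluded because beta^(-N) < x. *)
have ex : exists j : nat, x < (beta%:R : R) ^ (j%:Z - N%:Z).
  by exists (M + N)%N; rewrite PoszD addrK.
case: (ex_minnP ex) => -[|j] jP jmin.
  move: jP; rewrite sub0r -exprnN => /ltW.
  rewrite -[x in x <= _]invrK lef_pV2 ?posrE ?invr_gt0 ?exprn_gt0//.
  by rewrite leNgt xN.
exists (j.+1%:Z - N%:Z); rewrite jP andbT leNgt; apply/negP => xj.
suff /jmin : x < (beta%:R : R) ^ (j%:Z - N%:Z) by rewrite ltnn.
move: xj; rewrite -addn1 PoszD.
by rewrite (_ : j%:Z + 1 - N%:Z - 1 = j%:Z - N%:Z); last ring.
Qed.

Lemma floatsN (R : realType) (beta p : nat) (y : R) :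
  floats beta p y -> floats beta p (- y).
Proof.
move=> [s [m [e [m_bnd ->]]]]; exists (~~ s), m, e; split=> //.
by rewrite signrN !mulNr.
Qed.

(** If beta^(e-1) <= x < beta^e, the neighbours of x are the multiples m ulp and (m+1) ulp around
    it, with ulp = beta^(e-p). The gap is ulp = u beta^(e-1) <= u x. *)
Lemma floats_gap_pos (R : realType) (beta p : nat) (x : R) :
  (2 <= beta)%N -> (1 <= p)%N -> 0 < x -> ~ floats beta p x ->
  exists lo hi : R, [/\ floats beta p lo, floats beta p hi, lo < x < hi,
    hi - lo <= unit_roundoff R beta p * x &
    forall y, floats beta p y -> y <= lo \/ hi <= y].
Proof.
move=> beta2 p1 x0 xF.
have b0 : (0 : R) < beta%:R by rewrite ltr0n (leq_trans _ beta2).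
have b1 : (1 : R) <= beta%:R by rewrite ler1n (leq_trans _ beta2).
have bn0 : (beta%:R : R) != 0 by rewrite gt_eqF.
have [e /andP[ex xe]] := exists_exprz_itv beta2 x0.
pose ulp : R := beta%:R ^ (e - p%:Z).
have ulp0 : 0 < ulp by rewrite exprz_gt0.
have ulpX (k : nat) : (beta ^ k)%:R * ulp = beta%:R ^ (e - p%:Z + k%:Z).
  by rewrite natrX mulrC -[_ ^+ k]/(_ ^ k%:Z) -expfzDr.
have q0 : 0 <= x / ulp by rewrite ltW ?divr_gt0.
pose m := Num.truncn (x / ulp).
have /andP[mx xm] := truncn_itv q0; rewrite -/m in mx xm.
have ulpP : (beta ^ p)%:R * ulp = beta%:R ^ e by rewrite ulpX subrK.
have ulpP1 : (beta ^ (p - 1))%:R * ulp = beta%:R ^ (e - 1).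
  by rewrite ulpX -subzn//; congr (_ ^ _); ring.
have m_ge : (beta ^ (p - 1) <= m)%N.
  by rewrite truncn_ge_nat// ler_pdivlMr// ulpP1.
have m_lt : (m < beta ^ p)%N.
  by rewrite truncn_lt_nat// ltr_pdivrMr// ulpP.
have lo_le : m%:R * ulp <= x by rewrite -ler_pdivlMr.
have hi_gt : x < m.+1%:R * ulp by rewrite -ltr_pdivrMr.
have Flo : floats beta p (m%:R * ulp).
  by exists false, m, e; rewrite m_ge m_lt expr0 mul1r.
have Fhi : floats beta p (m.+1%:R * ulp).
  have [m1|m1] := ltnP m.+1 (beta ^ p).
    by exists false, m.+1, e; rewrite m1 (leq_trans m_ge)// expr0 mul1r.
  (* Here m+1 = beta^p: the upper neighbour is beta^e, which is normalized at the next exponent with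
     the least significand. *)
  exists false, (beta ^ (p - 1))%N, (e + 1); split.
    by rewrite leqnn /= ltn_exp2l ?subn1 ?prednK.
  have -> : m.+1 = (beta ^ p)%N by apply/eqP; rewrite eqn_leq m_lt m1.
  rewrite ulpP expr0 mul1r natrX -[_ ^+ (p - 1)]/(_ ^ (p - 1)%N%:Z) -expfzDr//.
  by rewrite -subzn//; congr (_ ^ _); ring.
exists (m%:R * ulp), (m.+1%:R * ulp); split=> //.
- rewrite hi_gt andbT lt_neqAle lo_le andbT.
  by apply/eqP => xE; apply: xF; rewrite -xE.
- rewrite -mulrBl -natrB// subSnn mul1r /ulp /unit_roundoff.
  rewrite (_ : e - p%:Z = 1 - p%:Z + (e - 1)); last ring.
  by rewrite expfzDr// ler_wpM2l// exprz_ge0// ltW.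
move=> y [s [k [f [/andP[k_ge k_lt] ->]]]].
case: s; rewrite ?expr1 ?expr0 ?mulN1r ?mul1r.
  left; apply: (@le_trans _ _ 0); last by rewrite mulr_ge0 ?ler0n ?ltW.
  by rewrite mulNr oppr_le0 mulr_ge0 ?ler0n ?exprz_ge0 ?ltW.
(* A float of exponent f < e is below beta^f <= beta^(e-1) <= m ulp. For f >= e it is an integer
   multiple of ulp, and no integer lies strictly between m and m+1. *)
have [fe|ef] := ltrP f e.
  left; apply: (@le_trans _ _ (beta%:R ^ f)).
    have -> : (beta%:R : R) ^ f = (beta ^ p)%:R * beta%:R ^ (f - p%:Z).
      by rewrite natrX -[_ ^+ p]/(_ ^ p%:Z) -expfzDr// addrC subrK.
    by rewrite ler_wpM2r ?exprz_ge0 ?ler_nat// ltnW.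
  apply: (@le_trans _ _ (beta%:R ^ (e - 1))).
    by rewrite ler_weXz2l// lerBrDr lezD1.
  by rewrite -ulpP1 ler_wpM2r ?ler_nat// ltW.
have [g gE] : exists g : nat, f - p%:Z = (e - p%:Z) + g%:Z.
  by exists `|f - e|%N; rewrite gez0_abs ?subr_ge0//; ring.
have -> : k%:R * beta%:R ^ (f - p%:Z) = (k * beta ^ g)%:R * ulp.
  by rewrite gE addrC expfzDr// natrM natrX mulrA.
have [km|mk] := leqP (k * beta ^ g) m; [left|right].
  by rewrite ler_wpM2r ?ler_nat// ltW.
by rewrite ler_wpM2r ?ler_nat// ltW.
Qed.

Lemma floats_gap (R : realType) (beta p : nat) (x : R) :
  (2 <= beta)%N -> (1 <= p)%N -> x != 0 -> ~ floats beta p x ->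
  exists lo hi : R, [/\ floats beta p lo, floats beta p hi, lo < x < hi,
    hi - lo <= unit_roundoff R beta p * `|x| &
    forall y, floats beta p y -> y <= lo \/ hi <= y].
Proof.
move=> beta2 p1 x0 xF; have [x_gt0|x_le0] := ltP 0 x.
  by rewrite gtr0_norm//; exact: floats_gap_pos.
have x_lt0 : 0 < - x by rewrite oppr_gt0 lt_neqAle x0.
have [|lo [hi [Flo Fhi /andP[lox xhi] gap adj]]] :=
  floats_gap_pos beta2 p1 x_lt0.
  by move=> /floatsN; rewrite opprK.
exists (- hi), (- lo); split; [exact: floatsN|exact: floatsN| | |].
- by rewrite ltrNl xhi ltrNr lox.
- by rewrite opprK addrC ler0_norm.
- by move=> y /floatsN /adj; rewrite lerNl lerNr; case; [right|left].
Qed.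

(** The adjacent floats around x are the unique minimum and maximum sought by [xget], so its default
    value is not reached. *)
Lemma round_gap (R : realType) (beta p : nat) (x : R) :
  (2 <= beta)%N -> (1 <= p)%N -> x != 0 -> ~ floats beta p x ->
  ffloor beta p x < x < fceil beta p x /\
  fceil beta p x - ffloor beta p x <= unit_roundoff R beta p * `|x|.
Proof.
move=> beta2 p1 x0 xF.
have [lo [hi [Flo Fhi /andP[lox xhi] gap adj]]] := floats_gap beta2 p1 x0 xF.
have -> : fceil beta p x = hi.
  apply: xget_unique => [|z [[Fz xz] zlb]].
    split=> [|y [Fy xy]]; first by split=> //; exact: ltW.
    by have [ylo|//] := adj y Fy;
      have := le_lt_trans (le_trans xy ylo) lox; rewrite ltxx.
  apply/eqP; rewrite eq_le zlb/=; last by split=> //; exact: ltW.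
  by have [zlo|//] := adj z Fz;
    have := le_lt_trans (le_trans xz zlo) lox; rewrite ltxx.
have -> : ffloor beta p x = lo.
  apply: xget_unique => [|z [[Fz zx] zub]].
    split=> [|y [Fy yx]]; first by split=> //; exact: ltW.
    by have [//|hiy] := adj y Fy;
      have := lt_le_trans xhi (le_trans hiy yx); rewrite ltxx.
  apply/eqP; rewrite eq_le zub ?andbT; last by split=> //; exact: ltW.
  by have [//|hiz] := adj z Fz;
    have := lt_le_trans xhi (le_trans hiz zx); rewrite ltxx.
by rewrite lox xhi.
Qed.

(** * The two-point law of a rounding error *)

(** Relative error when [c] is rounded up. Where [c] needs no rounding, both this and [err_down] are
    0, so a single two-point formula covers all cases. *)
Definition err_up (R : realType) (beta p : nat) (c : R) : R :=
  if c \in floats beta p `|` [set 0] then 0 else fceil beta p c / c - 1.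

Definition err_down (R : realType) (beta p : nat) (c : R) : R :=
  if c \in floats beta p `|` [set 0] then 0 else ffloor beta p c / c - 1.

Definition up_mass (R : realType) (beta p : nat) (c : R) : R :=
  if c \in floats beta p `|` [set 0] then 0 else ftheta beta p c.

(** For c nonzero, e -> c (1 + e) is injective, so the law of the rounded value transfers to the
    relative error. *)
Lemma fl_mass_err (R : realType) (beta p : nat) (c e : R) : c != 0 ->
  fl_mass beta p c (c * (1 + e)) =
  up_mass beta p c * (e == err_up beta p c)%:R
  + (1 - up_mass beta p c) * (e == err_down beta p c)%:R.
Proof.
move=> c0; rewrite /fl_mass /up_mass /err_up /err_down.
have relE z : (c * (1 + e) == z) = (e == z / c - 1).
  by rewrite eq_sym [RHS]eq_sym subr_eq addrC (can2_eq (mulfVK c0) (mulfK c0))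
    mulrC.
case: ifP => _; last by rewrite !relE.
by rewrite relE divff// subrr mul0r add0r subr0 mul1r.
Qed.

Lemma up_mass_itv (R : realType) (beta p : nat) (c : R) :
  (2 <= beta)%N -> (1 <= p)%N -> 0 <= up_mass beta p c <= 1.
Proof.
move=> beta2 p1; rewrite /up_mass; case: ifPn => [_|].
  by rewrite lexx ler01.
rewrite notin_setE => /not_orP[cF /eqP c0].
have [/andP[lc ch] _] := round_gap beta2 p1 c0 cF.
rewrite /ftheta ler_pdivlMr ?ler_pdivrMr ?subr_gt0 ?(lt_trans lc)//.
by rewrite mul0r mul1r subr_ge0 lerD2r !ltW.
Qed.

(** [ftheta] is the barycentric weight of [c] between its neighbours, so the rounded value has mean
    [c]. *)
Lemma err_mean0 (R : realType) (beta p : nat) (c : R) :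
  (2 <= beta)%N -> (1 <= p)%N ->
  up_mass beta p c * err_up beta p c
  + (1 - up_mass beta p c) * err_down beta p c = 0.
Proof.
move=> beta2 p1; rewrite /up_mass /err_up /err_down.
case: ifPn => [_|]; first by rewrite !mulr0 addr0.
rewrite notin_setE => /not_orP[cF /eqP c0].
have [/andP[lc ch] _] := round_gap beta2 p1 c0 cF.
have hl : fceil beta p c - ffloor beta p c != 0.
  by rewrite gt_eqF// subr_gt0 (lt_trans lc).
by rewrite /ftheta; field; rewrite c0 hl.
Qed.

(** Both neighbours are within the gap, hence within u |c|, of [c]. Each squared error is thus at
    most u^2, and so is their convex combination. *)
Lemma err_sqr (R : realType) (beta p : nat) (c : R) :
  (2 <= beta)%N -> (1 <= p)%N ->
  up_mass beta p c * err_up beta p c ^+ 2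
  + (1 - up_mass beta p c) * err_down beta p c ^+ 2
  <= unit_roundoff R beta p ^+ 2.
Proof.
move=> beta2 p1; have /andP[w0 w1] := up_mass_itv c beta2 p1.
set u := unit_roundoff R beta p.
suff [eu ed] :
    err_up beta p c ^+ 2 <= u ^+ 2 /\ err_down beta p c ^+ 2 <= u ^+ 2.
  rewrite [leRHS](_ : _ = up_mass beta p c * u ^+ 2
    + (1 - up_mass beta p c) * u ^+ 2); last by ring.
  by rewrite lerD// ler_wpM2l// subr_ge0.
rewrite /err_up /err_down; case: ifPn => [_|].
  by rewrite expr0n /= exprn_even_ge0.
rewrite notin_setE => /not_orP[cF /eqP c0].
have [/andP[lc ch] gap] := round_gap beta2 p1 c0 cF.
have relE z : z / c - 1 = (z - c) / c by field.
suff bnd z : `|z - c| <= u * `|c| -> (z / c - 1) ^+ 2 <= u ^+ 2.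
  split; apply: bnd; apply: le_trans gap.
    by rewrite gtr0_norm ?subr_gt0// lerD2l lerN2 ltW.
  by rewrite distrC gtr0_norm ?subr_gt0// lerD2r ltW.
move=> zc; rewrite relE -[leLHS]real_normK ?num_real// normf_div.
have zcu : `|z - c| / `|c| <= u by rewrite ler_pdivrMr ?normr_gt0.
by rewrite lerXn2r ?nnegrE ?divr_ge0// (le_trans _ zcu) ?divr_ge0.
Qed.

(** * Histories of errors and conditional means *)

Definition set_err (R : realType) (d : nat -> R) (k : nat) (e : R) : nat -> R :=
  fun j => if j == k then e else d j.

(* The conditional mean of g given the errors before the k-th one, averaging
   over the k-th error only. *)
Definition step_mean (R : realType) (beta p : nat)
    (exact : (nat -> R) -> nat -> R) (k : nat) (g : (nat -> R) -> R) :
    (nat -> R) -> R :=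
  fun d => let c := exact d k in
    up_mass beta p c * g (set_err d k (err_up beta p c))
    + (1 - up_mass beta p c) * g (set_err d k (err_down beta p c)).

(** The conditioning event of [SR_errors]. Only errors numbered from 1 to k-1 are fixed, so the
    history for [k] = 1 is the whole space. *)
Definition history (T : Type) (R : realType) (delta : nat -> T -> R)
    (k : nat) (d : nat -> R) : set T :=
  [set t | forall j, (1 <= j < k)%N -> delta j t = d j].

Lemma historyS (T : Type) (R : realType) (delta : nat -> T -> R)
    (k : nat) (d : nat -> R) (e : R) : (1 <= k)%N ->
  history delta k.+1 (set_err d k e) =
  history delta k d `&` [set t | delta k t = e].
Proof.
move=> k1; apply/seteqP; split=> t; rewrite /history /set_err /=.
  move=> ht; split=> [j /andP[j1 jk]|].
    by rewrite ht ?j1 ?ltnS ?(ltnW jk)// ltn_eqF.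
  by rewrite ht ?k1 ?ltnSn// eqxx.
move=> [ht hk] j /andP[j1]; rewrite ltnS leq_eqVlt => /predU1P[->|jk].
  by rewrite eqxx.
by rewrite ltn_eqF// ht// j1.
Qed.

Lemma measurable_eq_err (dsp : measure_display) (T : measurableType dsp)
    (R : realType) (f : {mfun T >-> R}) (e : R) :
  measurable [set t | f t = e].
Proof.
rewrite -[X in measurable X]setTI.
exact: (@measurable_funPT _ _ _ _ f measurableT [set e] (measurable_set1 e)).
Qed.

Lemma measurable_history (dsp : measure_display) (T : measurableType dsp)
    (R : realType) (delta : nat -> {mfun T >-> R}) (k : nat) (d : nat -> R) :
  measurable (history delta k d).
Proof.
elim: k => [|k IH].
  rewrite (_ : history _ _ _ = setT) //.
  by apply/seteqP; split=> // t _ j; rewrite ltn0 andbF.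
case: k => [|k] in IH *.
  rewrite (_ : history _ _ _ = setT) //.
  by apply/seteqP; split=> // t _ j; rewrite ltnS leqn0 lt0n andNb.
(* [d] is seen as an update of itself, so that [historyS] can split off the last condition. *)
rewrite (_ : d = set_err d k.+1 (d k.+1)); last first.
  by apply/funext => j; rewrite /set_err; case: eqP => // ->.
by rewrite historyS//; apply: measurableI => //; exact: measurable_eq_err.
Qed.

(** * Integrals as iterated two-point means *)

Section conditional_mean.
Context (dsp : measure_display) (T : measurableType dsp) (R : realType)
  (P : probability T R) (beta p N : nat) (exact : (nat -> R) -> nat -> R)
  (delta : nat -> {RV P >-> R}).
Hypothesis exact_past : forall d d' k,
  (forall j, (1 <= j < k)%N -> d j = d' j) -> exact d k = exact d' k.
Hypothesis hdelta : SR_errors beta p N exact delta.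

(** By [exact_past] the exact result is constant on a history, so the law of the computed value
    becomes a two-point law for the error itself. *)
Lemma history_err (k : nat) (d : nat -> R) (e : R) : (1 <= k <= N)%N ->
  P (history delta k d `&` [set t | delta k t = e]) =
  ((up_mass beta p (exact d k) * (e == err_up beta p (exact d k))%:R
   + (1 - up_mass beta p (exact d k))
     * (e == err_down beta p (exact d k))%:R)%:E
   * P (history delta k d))%E.
Proof.
move=> kN; have [delta0 law] := hdelta kN.
have exactE t : history delta k d t -> exact (fun j => delta j t) k = exact d k.
  by move=> ht; apply: exact_past.
(* If c = 0, the value c (1 + e) does not determine e; the clause of [SR_errors] forcing a zero
   error is used instead. *)
have [c0|c0] := eqVneq (exact d k) 0.
  have F0 : exact d k \in floats beta p `|` [set 0] by rewrite inE; right.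
  rewrite /up_mass /err_up /err_down F0 mul0r add0r subr0 mul1r.
  have [->|e0] := eqVneq e 0.
    rewrite mul1e; congr (P _); apply/seteqP; split=> [t []//|t ht]; split=> //.
    by apply: delta0; rewrite exactE.
  rewrite mul0e (_ : _ `&` _ = set0) ?measure0//.
  apply/seteqP; split=> // t [ht /= te]; move/eqP: e0; apply.
  by rewrite -te; apply: delta0; rewrite exactE.
rewrite -fl_mass_err// -law; congr (P _).
apply/seteqP; split=> t [ht /= te]; split=> //=; first by rewrite exactE// te.
by move: te; rewrite exactE// => /(mulfI c0) /addrI.
Qed.

(** Backward induction along the tree, [m] being the number of operations still to come: a history
    splits, up to a null set, into the branches of its next error. *)
Lemma integral_history (g : (nat -> R) -> R) :
  (forall d d', (forall j, (1 <= j <= N)%N -> d j = d' j) -> g d = g d') ->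
  measurable_fun setT (fun t => g (fun j => delta j t)) ->
  forall m k d, (1 <= k)%N -> (k + m = N.+1)%N ->
  (\int[P]_(t in history delta k d) (g (fun j => delta j t))%:E)%E =
  ((foldr (step_mean beta p exact) g (iota k m) d)%:E
   * P (history delta k d))%E.
Proof.
move=> g_past mg; elim=> [|m IH] k d k1 kmN.
  (* At a leaf [k] = [N].+1: every error on which [g] depends is fixed. *)
  rewrite -integral_cst; last exact: measurable_history.
  apply: eq_integral => t; rewrite inE => ht /=; congr (_%:E).
  by apply: g_past; move: ht; rewrite -[k]addn0 kmN.
have kN : (1 <= k <= N)%N.
  by rewrite k1 -[(k <= N)%N]ltnS -kmN addnS ltnS leq_addr.
set H := history delta k d; set c := exact d k.
set up := err_up beta p c; set dn := err_down beta p c.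
set w := up_mass beta p c.
pose V := foldr (step_mean beta p exact) g (iota k.+1 m).
have -> : foldr (step_mean beta p exact) g (iota k m.+1) d =
  w * V (set_err d k up) + (1 - w) * V (set_err d k dn) by [].
pose at_ e := H `&` [set t | delta k t = e].
have mH : measurable H by exact: measurable_history.
have mat e : measurable (at_ e).
  by apply: measurableI => //; exact: measurable_eq_err.
have IHat e : (\int[P]_(t in at_ e) (g (fun j => delta j t))%:E)%E =
    ((V (set_err d k e))%:E * P (at_ e))%E.
  by rewrite /at_ -historyS// IH// addSnnS.
have Pat e : P (at_ e) =
    ((w * (e == up)%:R + (1 - w) * (e == dn)%:R)%:E * P H)%E.
  exact: history_err.
have PHfin : P H \is a fin_num by exact: fin_num_measure.
have mG A : measurable_fun A (EFin \o (fun t => g (fun j => delta j t))).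
  apply: measurable_funS measurableT (@subsetT _ A) _.
  exact/measurable_EFinP.
pose U := at_ up `|` at_ dn.
have mU : measurable U by exact: measurableU.
have UH : U `<=` H by move=> t [] [].
have split_int A B : measurable A -> measurable B -> A `&` B = set0 ->
    (\int[P]_(t in A `|` B) (g (fun j => delta j t))%:E =
     \int[P]_(t in A) (g (fun j => delta j t))%:E +
     \int[P]_(t in B) (g (fun j => delta j t))%:E)%E.
  by move=> mA mB AB0; rewrite integral_setU//; apply/disj_setPS; rewrite AB0.
have [PU intU] : P U = P H /\ (\int[P]_(t in U) (g (fun j => delta j t))%:E)%E =
    ((w * V (set_err d k up) + (1 - w) * V (set_err d k dn))%:E * P H)%E.
  (* The two branches coincide when the exact result needs no rounding. *)
  have [updn|updn] := eqVneq up dn.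
    rewrite /U -updn setUid IHat Pat eqxx -updn eqxx !mulr1 addrC subrK mul1e.
    by split=> //; congr (_%:E * _)%E; ring.
  have UD0 : at_ up `&` at_ dn = set0.
    apply/seteqP; split=> // t [[_ /= tu] [_ /= td]].
    by move/eqP: updn; apply; rewrite -tu.
  have PUE : P U = (P (at_ up) + P (at_ dn))%E by rewrite /U measureU.
  rewrite PUE split_int// !IHat !Pat !eqxx [dn == _]eq_sym (negbTE updn).
  rewrite !mulr0 !mulr1 addr0 add0r -[P H]fineK// -!EFinM -!EFinD.
  by split; congr (_%:E); ring.
(* The two branches carry all the mass of [H], so the rest is null and adds nothing to the
   integral. *)
have PHU : P (H `\` U) = 0%E.
  have -> : P (H `\` U) = (P H - P U)%E.
    by rewrite measureD ?setIidr// -ge0_fin_numE.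
  by rewrite PU subee.
rewrite -{1}(setDUK UH) split_int//; first last.
- by rewrite setDE setICA setICr setI0.
- exact: measurableD.
by rewrite intU null_set_integral ?adde0//; exact: measurableD.
Qed.

End conditional_mean.

(** * Algebra of the iterated mean *)

Section mean_operator.
Context (R : realType) (beta p : nat) (exact : (nat -> R) -> nat -> R).
Hypotheses (beta2 : (2 <= beta)%N) (p1 : (1 <= p)%N).

Local Notation mean := (foldr (step_mean beta p exact)).

Lemma mean_le (g h : (nat -> R) -> R) (s : seq nat) :
  (forall d, g d <= h d) -> forall d, mean g s d <= mean h s d.
Proof.
move=> gh; elim: s => //= k s IH d.
have /andP[w0 w1] := up_mass_itv (exact d k) beta2 p1.
by rewrite /step_mean lerD// ler_wpM2l// subr_ge0.
Qed.

(** The two weights of each step sum to 1, so constants pass through. *)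
Lemma mean_affine (g h : (nat -> R) -> R) (al be c : R) (s : seq nat)
    (d : nat -> R) :
  mean (fun d => al * g d + be * h d + c) s d =
  al * mean g s d + be * mean h s d + c.
Proof.
elim: s d => //= k s IH d; rewrite /step_mean !IH; ring.
Qed.

(** [foldr] averages over the last error first. Isolating this innermost mean lets one-step
    estimates feed an induction on the number of operations. *)
Lemma mean_rcons (g : (nat -> R) -> R) (m : nat) :
  mean g (iota 1 m.+1) = mean (step_mean beta p exact m.+1 g) (iota 1 m).
Proof. by rewrite -{1}[m.+1]addn1 iotaD foldr_cat add1n. Qed.

End mean_operator.

Lemma eq_mean (R : realType) (beta p : nat) (exact : (nat -> R) -> nat -> R)
    (g h : (nat -> R) -> R) (s : seq nat)
    (d : nat -> R) :
  g =1 h ->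
  foldr (step_mean beta p exact) g s d = foldr (step_mean beta p exact) h s d.
Proof. by move=> /funext ->. Qed.

(** * Horner's rule as an affine recursion *)

Section horner.
Context (R : realType) (n : nat) (a : nat -> R) (x : R).

(** Products and additions are both affine in the previous value; slope and shift let the moment
    recursions treat them alike. *)
Definition op_slope (y : R) (k : nat) : R := if odd k then y else 1.
Definition op_shift (b : nat -> R) (k : nat) : R :=
  if odd k then 0 else b (n - k./2)%N.

Lemma horner_opE (b : nat -> R) (y : R) k r :
  horner_op n b y k r = op_slope y k * r + op_shift b k.
Proof.
by rewrite /horner_op /op_slope /op_shift; case: ifP;
  rewrite ?addr0 ?mul1r // mulrC.
Qed.

Lemma horner_hat_past (d d' : nat -> R) (k : nat) :
  (forall j, (1 <= j <= k)%N -> d j = d' j) ->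
  horner_hat n a x d k = horner_hat n a x d' k.
Proof.
elim: k => //= k IH dd'; rewrite IH ?dd' ?leqnn// => j /andP[j1 jk].
by rewrite dd'// j1 ltnW.
Qed.

Lemma horner_exact_past (d d' : nat -> R) (k : nat) :
  (forall j, (1 <= j < k)%N -> d j = d' j) ->
  horner_exact n a x d k = horner_exact n a x d' k.
Proof.
case: k => [|k] dd'; first by [].
by rewrite /horner_exact /= (@horner_hat_past d d').
Qed.

Lemma horner_hat_set_err (d : nat -> R) (k : nat) (e : R) :
  horner_hat n a x (set_err d k.+1 e) k.+1 =
  horner_exact n a x d k.+1 * (1 + e).
Proof.
rewrite /= /horner_exact /= {2}/set_err eqxx; congr (horner_op _ _ _ _ _ * _).
by apply: horner_hat_past => j /andP[_ jk]; rewrite /set_err ltn_eqF.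
Qed.

(** Error-free Horner values; coefficients and point are left free so that the recursion also serves
    |a_i| and |x|. *)
Definition horner0 (b : nat -> R) (y : R) (k : nat) : R :=
  horner_hat n b y (fun=> 0) k.

Lemma horner0S b y k :
  horner0 b y k.+1 = op_slope y k.+1 * horner0 b y k + op_shift b k.+1.
Proof. by rewrite /horner0 /= addr0 mulr1 horner_opE. Qed.

(** After 2k operations exactly the k+1 leading coefficients have entered; [k] = [n] gives the whole
    polynomial. *)
Lemma horner0_sum (b : nat -> R) (y : R) (k : nat) : (k <= n)%N ->
  horner0 b y (2 * k) = \sum_(i < k.+1) b (n - k + i)%N * y ^+ i.
Proof.
elim: k => [|k IH] kn.
  by rewrite big_ord_recl big_ord0 /= addr0 mulr1 subn0 addn0.
rewrite /horner0 horner_hat_add// horner_hat_mul// !addr0 !mulr1.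
rewrite (_ : 2 * k.+1 - 2 = 2 * k)%N; last by rewrite mulnS addKn.
have := IH (ltnW kn); rewrite {1}/horner0 => ->.
rewrite big_distrl /= [RHS]big_ord_recl /=.
rewrite expr0 mulr1 addn0 addrC; congr (_ + _); apply: eq_bigr => i _.
rewrite -mulrA -exprSr; congr (b _ * _).
by rewrite /bump /= addnA addn1 subnSK.
Qed.

(** The majorant S_k, which ends at the sum of the |a_i x^i|. *)
Definition abs_horner (k : nat) : R := horner0 (fun i => `|a i|) `|x| k.

Lemma abs_hornerS k :
  abs_horner k.+1 = `|op_slope x k.+1| * abs_horner k + `|op_shift a k.+1|.
Proof.
by rewrite /abs_horner horner0S /op_slope /op_shift; case: ifP;
  rewrite ?normr1 ?normr0.
Qed.

Lemma horner0_le_abs k : `|horner0 a x k| <= abs_horner k.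
Proof.
elim: k => [|k IH]; first exact: lexx.
rewrite horner0S abs_hornerS (le_trans (ler_normD _ _))// lerD2r normrM.
by rewrite ler_wpM2l.
Qed.

End horner.

(** * Moments of the computed Horner values *)

(** Used with W = (1+v)^k and v = u^2. Since al^2 S^2 <= Y, the second factor on the left is at most
    X + Y (W - 1). After multiplication by 1 + v, X <= Y gives v X <= v Y, which leaves X + Y ((1+v)
    W - 1). *)
Lemma second_moment_step (R : realType) (al be r S M2 v W : R) :
  0 <= v -> 1 <= W -> `|r| <= S -> M2 <= r ^+ 2 + S ^+ 2 * (W - 1) ->
  (1 + v) * (al ^+ 2 * M2 + 2 * al * be * r + be ^+ 2) <=
  (al * r + be) ^+ 2 + (`|al| * S + `|be|) ^+ 2 * ((1 + v) * W - 1).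
Proof.
move=> v0 W1 rS M2le.
have S0 : 0 <= S by exact: le_trans (normr_ge0 r) rS.
set X := (al * r + be) ^+ 2; set Y := (`|al| * S + `|be|) ^+ 2.
have XY : X <= Y.
  rewrite /X -[leLHS]real_normK ?num_real//.
  rewrite lerXn2r ?nnegrE ?addr_ge0 ?mulr_ge0//.
  by rewrite (le_trans (ler_normD _ _))// lerD2r normrM ler_wpM2l.
have alS : al ^+ 2 * S ^+ 2 <= Y.
  rewrite -[al ^+ 2]real_normK ?num_real// -exprMn.
  by rewrite lerXn2r ?nnegrE ?addr_ge0 ?mulr_ge0// lerDl.
have step1 : al ^+ 2 * M2 + 2 * al * be * r + be ^+ 2 <= X + Y * (W - 1).
  have : al ^+ 2 * M2 <= al ^+ 2 * (r ^+ 2 + S ^+ 2 * (W - 1)).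
    by rewrite ler_wpM2l ?sqr_ge0.
  have : al ^+ 2 * S ^+ 2 * (W - 1) <= Y * (W - 1).
    by rewrite ler_wpM2r ?subr_ge0.
  rewrite /X; lra.
have v1 : 0 <= 1 + v by rewrite addr_ge0.
apply: le_trans (ler_wpM2l v1 step1) _.
have : v * X <= v * Y by rewrite ler_wpM2l.
lra.
Qed.

Section horner_moments.
Context (R : realType) (beta p n : nat) (a : nat -> R) (x : R).
Hypotheses (beta2 : (2 <= beta)%N) (p1 : (1 <= p)%N).

Local Notation exact := (horner_exact n a x).
Local Notation mean k g := (foldr (step_mean beta p exact) g (iota 1 k)).
Local Notation rhat k := (fun d => horner_hat n a x d k).
Local Notation u := (unit_roundoff R beta p).

Lemma step_mean_horner k (d : nat -> R) :
  step_mean beta p exact k.+1 (rhat k.+1) d = exact d k.+1.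
Proof.
rewrite /step_mean !horner_hat_set_err; set c := exact d k.+1.
rewrite -[RHS]addr0 -(mulr0 c) -(err_mean0 c beta2 p1); ring.
Qed.

(** In the mean of (1 + e)^2 the linear term vanishes and the quadratic one is at most u^2. *)
Lemma step_mean_horner_sqr k (d : nat -> R) :
  step_mean beta p exact k.+1 (fun d => rhat k.+1 d ^+ 2) d <=
  (1 + u ^+ 2) * exact d k.+1 ^+ 2.
Proof.
rewrite /step_mean !horner_hat_set_err; set c := exact d k.+1.
rewrite [leLHS](_ : _ = c ^+ 2 * (1 + 2 * (up_mass beta p c * err_up beta p c
    + (1 - up_mass beta p c) * err_down beta p c)
    + (up_mass beta p c * err_up beta p c ^+ 2
    + (1 - up_mass beta p c) * err_down beta p c ^+ 2))); last by ring.
by rewrite err_mean0// mulr0 addr0 mulrC ler_wpM2r ?sqr_ge0// lerD2l err_sqr.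
Qed.

Lemma exactS d k :
  exact d k.+1 = op_slope x k.+1 * rhat k d + op_shift n a k.+1.
Proof. exact: horner_opE. Qed.

Lemma mean_horner k d : mean k (rhat k) d = horner0 n a x k.
Proof.
elim: k => [//|k IH]; rewrite mean_rcons.
rewrite (eq_mean _ _ _ _ _ (step_mean_horner k)) horner0S -IH.
rewrite (eq_mean _ _ _ _ _ (exactS^~ k)).
(* Only one function is averaged here; the second slot of [mean_affine] gets weight 0. *)
have := mean_affine beta p exact (rhat k) (rhat k) (op_slope x k.+1) 0
  (op_shift n a k.+1) (iota 1 k) d.
rewrite mul0r addr0 => <-; apply: eq_mean => d'; ring.
Qed.

Lemma mean_horner_sqr k d :
  mean k (fun d => rhat k d ^+ 2) d <=
  horner0 n a x k ^+ 2 + abs_horner n a x k ^+ 2 * ((1 + u ^+ 2) ^+ k - 1).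
Proof.
elim: k => [|k IH]; first by rewrite /= expr0 subrr mulr0 addr0.
rewrite mean_rcons.
apply: le_trans (mean_le _ beta2 p1 _ (step_mean_horner_sqr k) d) _.
set al := op_slope x k.+1; set be := op_shift n a k.+1.
(* Expanding the square of al r + be leaves a cross term linear in r, whose mean is known exactly
   from [mean_horner]. *)
rewrite (eq_mean _ _ _ _ _ (_ : _ =1 fun d =>
    ((1 + u ^+ 2) * al ^+ 2) * rhat k d ^+ 2
    + ((1 + u ^+ 2) * (2 * al * be)) * rhat k d
    + (1 + u ^+ 2) * be ^+ 2)); last first.
  by move=> d'; rewrite exactS -/al -/be; ring.
rewrite mean_affine mean_horner horner0S abs_hornerS -/al -/be [_ ^+ k.+1]exprS.
rewrite [leLHS](_ : _ = (1 + u ^+ 2) *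
  (al ^+ 2 * mean k (fun d => rhat k d ^+ 2) d
   + 2 * al * be * horner0 n a x k + be ^+ 2)); last by ring.
apply: second_moment_step => //; [exact: sqr_ge0| |exact: horner0_le_abs].
by rewrite exprn_ege1// lerDl sqr_ge0.
Qed.

End horner_moments.

(** * Expectation and variance of the computed value *)

Theorem theorem3p5 (dsp : measure_display) (T : measurableType dsp)
    (R : realType) (P : probability T R)
    (beta p : nat) (hbeta : (2 <= beta)%N) (hp : (1 <= p)%N)
    (n : nat) (hn : (1 <= n)%N) (a : nat -> R) (x : R)
    (hP : poly_val n a x != 0)
    (delta : nat -> {RV P >-> R})
    (hdelta : SR_errors beta p (2 * n) (horner_exact n a x) delta) :
  let u : R := unit_roundoff R beta p in
  let rhat : T -> R :=
    fun t => horner_hat n a x (fun j => delta j t) (2 * n) in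
  'E_P[rhat]%E = (poly_val n a x)%:E /\
  ('V_P[rhat] <=
     ((poly_val n a x) ^+ 2 * (cond_K1 n a x) ^+ 2 * gamma (2 * n) (u ^+ 2))%:E)%E.
Proof.
move=> u rhat.
have meas_rhat k : measurable_fun setT
    (fun t => horner_hat n a x (fun j => delta j t) k).
  elim: k => [|k IH] /=; first exact: measurable_cst.
  under eq_fun do rewrite horner_opE.
  apply: measurable_funM; last exact: measurable_funD.
  by apply: measurable_funD => //; exact: measurable_funM.
(* The history before the first operation has probability 1, so the integral over it is the full
   expectation. *)
have expect (h : R -> R) : measurable_fun setT h ->
    (\int[P]_t (h (rhat t))%:E)%E =
    (foldr (step_mean beta p (horner_exact n a x))
      (fun d => h (horner_hat n a x d (2 * n))) (iota 1 (2 * n)) (fun=> 0))%:E.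
  move=> mh.
  have histT : history (fun k => delta k : T -> R) 1 (fun=> 0) = setT.
    by apply/seteqP; split=> // t _ j; rewrite ltnS leqn0 lt0n andNb.
  have := integral_history (@horner_exact_past R n a x) hdelta
    (g := fun d => h (horner_hat n a x d (2 * n))) _ _ (fun=> 0)
    (leqnn 1) (add1n _).
  rewrite histT probability_setT mule1; apply.
    by move=> d d' dd'; rewrite (horner_hat_past _ _ _ dd').
  exact: measurableT_comp.
have pvE : horner0 n a x (2 * n) = poly_val n a x.
  by rewrite horner0_sum// subnn.
have ER : 'E_P[rhat]%E = (poly_val n a x)%:E.
  by rewrite unlock (expect id)//= mean_horner// pvE.
split=> //; rewrite /variance unlock ER /= unlock.
set c := poly_val n a x in hP pvE *.
rewrite (expect (fun y => (y - c) * (y - c))); last first.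
  by apply: measurable_funM; apply: measurable_funB.
(* As the mean is c, expanding (y - c)^2 reduces the variance to the second moment minus c^2, and
   this cancels the leading term of [mean_horner_sqr]. *)
rewrite lee_fin (eq_mean _ _ _ _ _ (_ : _ =1 fun d =>
   1 * horner_hat n a x d (2 * n) ^+ 2 + (- 2 * c) * horner_hat n a x d (2 * n)
   + c ^+ 2)); last by move=> d; ring.
rewrite mean_affine mean_horner// pvE mul1r.
have := mean_horner_sqr n a x hbeta hp (2 * n) (fun=> 0).
rewrite pvE -/u => m2.
(* The denominator |c| of K_1 cancels because P(x) is nonzero. *)
have -> : c ^+ 2 * cond_K1 n a x ^+ 2 = abs_horner n a x (2 * n) ^+ 2.
  rewrite /cond_K1 -/(poly_val n a x) -/c expr_div_n real_normK ?num_real//.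
  rewrite mulrC divfK ?expf_neq0// /abs_horner horner0_sum// subnn.
  by congr (_ ^+ 2); apply: eq_bigr => i _; rewrite normrM normrX.
rewrite /gamma; lra.
Qed.
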